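(* Fix real numbers $a>b>0$ and an integer $k\ge2$. Let $p=p(n)=\omega\,a/n$ and $q=q(n)=\omega\,b/n$. For any $\varepsilon>0$ and any $\delta<\frac{a-b}{a+(k-1)b}\cdot\frac{2}{k^2}$, there exists $c=c(\varepsilon)$ such that, if $\omega>c$ for $n$ large enough, then the following holds with probability at least $1-\varepsilon$ provided $n$ is large enough. Let $G\in\mathcal{G}(n,k,p,q)$ with planted partition $\mathcal{P}$. Then $q_{\mathcal{A}}(G)>q^\star(G)-\delta$ for some $k$-part partition $\mathcal{A}$ of $[n]$ implies $d(\mathcal{A},\mathcal{P})<\delta'+\varepsilon$ (i.e. every $k$-part partition $\mathcal{A}$ with $q_{\mathcal{A}}(G)>q^\star(G)-\delta$ satisfies $d(\mathcal{A},\mathcal{P})<\delta'+\varepsilon$), where $\delta'=\delta'(\delta)\in\left(0,\frac{1}{k(k-1)}\right)$.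
   Context: Modularity: for a graph $G=(V,E)$ with $m=|E|\ge1$ edges and a partition $\mathcal{A}$ of $V$, $q_{\mathcal{A}}(G)=\sum_{A\in\mathcal{A}}\frac{e(A)}{m}-\sum_{A\in\mathcal{A}}\left(\frac{\mathrm{vol}(A)}{\mathrm{vol}(V)}\right)^2$, where $e(A)$ is the number of edges inside $A$ and $\mathrm{vol}(A)=\sum_{v\in A}d_v$ is the sum of degrees. $q^\star(G)=\max_{\mathcal{A}}q_{\mathcal{A}}(G)$, the maximum being over all partitions of $V$ (any number of parts). Stochastic block model $\mathcal{G}(n,k,p,q)$: the vertex set $[n]$ is partitioned into $k$ communities $P_1,\dots,P_k$ with $\lfloor n/k\rfloor\le|P_i|\le\lceil n/k\rceil$ (the planted partition $\mathcal{P}=(P_i)_{i=1}^k$); independently for each pair of vertices, an edge is present with probability $p$ if both are in the same community and with probability $q$ otherwise. Here $k$ is fixed, $n\to\infty$, and $\omega=\omega(n)$ may depend on $n$. Distance: for a $k$-part partition $\mathcal{A}=(A_i)_{i=1}^k$, $d(\mathcal{A},\mathcal{P})=1-\frac1n\max_\sigma\sum_{i=1}^k|A_{\sigma(i)}\cap P_i|$, the maximum being over all permutations $\sigma$ of $[k]$. The notation $\delta'=\delta'(\delta)$ means that $\delta'$ is a number determined by $\delta$ (and the fixed $a,b,k$), not depending on $n$ or $\varepsilon$. Convention: parts of a $k$-part partition may be empty.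
   Formalization: The constant c is allowed to depend on δ as well as on ε (and a, b, k): with c depending on ε alone the claim fails for δ close to the threshold (e.g. k=3, a=2b, constant ω). It is also made explicit that p=ωa/n is at most 1 for n large. *)

(* Defs.v *)
From HB Require Import structures.
From mathcomp Require Import all_boot all_order all_fingroup all_algebra.
From mathcomp Require Import reals.
Set Implicit Arguments.
Unset Strict Implicit.
Unset Printing Implicit Defensive.
Import Order.TTheory GRing.Theory Num.Theory.
Local Open Scope ring_scope.

Section Modularity.
Variables (R : realType) (V : finType).

(* A simple graph on V is represented by its edge set, a set of 2-element
   subsets of V. *)
Definition vpairs : {set {set V}} := [set e : {set V} | #|e| == 2%N].

Definition edges_in (E : {set {set V}}) (A : {set V}) : nat :=
  #|[set e in E | e \subset A]|.

Definition degree (E : {set {set V}}) (v : V) : nat :=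
  #|[set e in E | v \in e]|.

Definition vol (E : {set {set V}}) (A : {set V}) : nat :=
  (\sum_(v in A) degree E v)%N.

(* For an edgeless graph the divisions by zero make this 0. *)
Definition modularity (E PA : {set {set V}}) : R :=
  \sum_(A in PA) (edges_in E A)%:R / #|E|%:R
  - \sum_(A in PA) ((vol E A)%:R / (vol E [set: V])%:R) ^+ 2.

(* The starting value of the iterated maximum is the modularity of the
   one-block partition, so for nonempty V this is the maximum over the
   partitions of V. *)
Definition max_modularity (E : {set {set V}}) : R :=
  \big[Num.max/modularity E [set [set: V]]]_(PA : {set {set V}}
    | partition PA [set: V]) modularity E PA.

(* Unlike [partition], empty parts are allowed. *)
Definition kpartition (k : nat) (A : {ffun 'I_k -> {set V}}) : bool :=
  [forall i, forall j, (i != j) ==> [disjoint A i & A j]]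
  && (\bigcup_i A i == [set: V]).

(* An empty part contributes 0 to the modularity, so the possible collapsing
   of several empty parts into one element of the set of parts is harmless. *)
Definition parts (k : nat) (A : {ffun 'I_k -> {set V}}) : {set {set V}} :=
  [set A i | i : 'I_k].

(* floor (|V| / k) <= |P_i| <= ceil (|V| / k) *)
Definition balanced (k : nat) (P : {ffun 'I_k -> {set V}}) : bool :=
  [forall i, (#|V| %/ k <= #|P i| <= (#|V| + k.-1) %/ k)%N].

Definition kdist (k : nat) (A P : {ffun 'I_k -> {set V}}) : R :=
  1 - (\max_(s : 'S_k) \sum_(i < k) #|A (s i) :&: P i|)%N%:R / #|V|%:R.

Definition sbm_edge_prob (k : nat) (P : {ffun 'I_k -> {set V}}) (p q : R)
    (e : {set V}) : R :=
  if [exists i, e \subset P i] then p else q.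

(* Probability that the edge set of the stochastic block model with planted
   partition P satisfies [event], for p and q in [0, 1]. *)
Definition sbm_prob (k : nat) (P : {ffun 'I_k -> {set V}}) (p q : R)
    (event : pred {set {set V}}) : R :=
  \sum_(E in powerset vpairs | event E)
    \prod_(e in vpairs)
      (if e \in E then sbm_edge_prob P p q e else 1 - sbm_edge_prob P p q e).

End Modularity.

(* Main.v *)
Require Import Defs.
From HB Require Import structures.
From mathcomp Require Import all_classical reals topology sequences exp.
From mathcomp Require Import all_boot all_order all_fingroup all_algebra.
From mathcomp Require Import ring lra.
Set Implicit Arguments.
Unset Strict Implicit.
Unset Printing Implicit Defensive.
Import Order.TTheory GRing.Theory Num.Theory.
Local Open Scope ring_scope.

(** Write e(S) for the number of edges inside a vertex set S.  The modularity
    of a partition depends on the graph only through the numbers e(S), because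
    the volume of S is |E| + e(S) - e(S^c) ([volE]).  The law of large numbers
    for e(S) is uniform in S: a Chernoff bound gives each of the 2^n sets S a
    probability of deviating by a small multiple of omega n which is
    exponentially small in omega n, so a union bound succeeds once omega exceeds
    a constant ([sbm_edges_concentrate], [deviation_bound_small]).

    On this event, the modularity of a k-part partition A is close to a
    function of the matrix X i j = |A_i /\ P_j| / |P_j|, whose columns are
    probability vectors.  With D = a + (k - 1) b it is
      (a - b) / (D k^2) * (k^2 - k - defect X),
      defect X = (k - 1) sum_j (1 - |col_j|^2) + sum_i ((row sum i)^2 - |row_i|^2)
    ([modularity_close]).  The defect is nonnegative and vanishes at the planted
    partition, so a partition within delta of the optimum has defect at most
    about delta D k^2 / (a - b), which is less than 2 by the choice of delta
    ([defect_lt]).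

    It remains to prove that a column-stochastic X with defect less than 2 is
    close to a permutation matrix.  For a permutation s let u be the total mass
    sum_j (1 - X (s j) j) that s misplaces.  Then
      defect X >= 2 u (k - (k - 1) u)
    for every s ([defect_ge_misplaced]).  The right-hand side is a concave
    quadratic in u, equal to 2 at u = 1 / (k - 1) and at u = 1.  Hence a defect
    less than 2 forces u < 1 / (k - 1) or u > 1, and on the first branch
    concavity gives 2 (k - 1) u <= defect X.  Some s lies on the first branch
    ([exists_misplaced_le1]).  For k = 2 this is because the two permutations
    misplace a total mass of 2.  For k >= 3, rounding the columns of X one at a
    time to basis vectors, in the right directions, does not increase the
    defect, and ends at a 0-1 matrix of defect less than 2, which is a
    permutation matrix s; when the columns are restored one at a time, u stays
    below 1 / (k - 1).  The distance to the planted partition is at most u / k up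
    to O(1/n), hence the linear function of delta in [max_distance]. *)

(** * Column-stochastic matrices *)

Section Sums.
Variable R : realFieldType.

Lemma sum_sqr_le (I : finType) (P : pred I) (f : I -> R) :
  (forall i, P i -> 0 <= f i) ->
  \sum_(i | P i) f i ^+ 2 <= (\sum_(i | P i) f i) ^+ 2.
Proof.
move=> f0; rewrite expr2 mulr_suml; apply: ler_sum => i Pi.
rewrite expr2 ler_wpM2l ?f0 // (bigD1 i) //= lerDl sumr_ge0 // => j /andP[Pj _].
exact: f0.
Qed.

(** Keeps only the cross terms that involve the index j. *)
Lemma sqr_sum_pivot (I : finType) (f : I -> R) (j : I) :
  (forall i, 0 <= f i) ->
  2 * f j * (\sum_i f i - f j) + \sum_i f i ^+ 2 <= (\sum_i f i) ^+ 2.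
Proof.
move=> f0; rewrite (bigD1 j) //= (bigD1 j (F := fun i => f i ^+ 2)) //=.
have := @sum_sqr_le I (fun i => i != j) f (fun i _ => f0 i).
set S := \sum_(i | i != j) f i; set T := \sum_(i | i != j) f i ^+ 2.
nra.
Qed.
End Sums.

Section Stochastic.
Variables (R : realFieldType) (k : nat).
Implicit Types (X : 'I_k -> 'I_k -> R) (s : 'S_k).

Definition col_stochastic X :=
  (forall i j, 0 <= X i j) /\ (forall j, \sum_i X i j = 1).

(** Equals the sum over pairs j < j' of 2 - |col_j - col_j'|^2, so that among
    column-stochastic matrices it vanishes exactly at the permutation matrices;
    the form below separates how far each column is from a basis vector and how
    much the columns overlap. *)
Definition defect X : R :=
  (k%:R - 1) * \sum_j (1 - \sum_i X i j ^+ 2)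
  + \sum_i ((\sum_j X i j) ^+ 2 - \sum_j X i j ^+ 2).

Definition misplaced X s : R := \sum_j (1 - X (s j) j).

Lemma stochastic_le1 X i j : col_stochastic X -> X i j <= 1.
Proof.
by move=> [X0 X1]; rewrite -(X1 j) (bigD1 i) //= lerDl sumr_ge0.
Qed.

Lemma col_sqr_le1 X j : col_stochastic X -> \sum_i X i j ^+ 2 <= 1.
Proof.
move=> SX; have [X0 X1] := SX; rewrite -[leRHS](X1 j); apply: ler_sum => i _.
by rewrite expr2 ler_piMr // stochastic_le1.
Qed.

(** With d j = 1 - X (s j) j, column j contributes at least 2 (d j - d j ^ 2),
    and row s j at least 2 (1 - d j) t j, where t j is the off-diagonal mass of
    that row.  This mass comes from the other columns, whence t j <= u - d j:
    using this rather than the trivial 1 - d j >= 1 - u is what makes the bound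
    sharp, with equality when X differs from a permutation matrix by moving mass
    between two rows of a single column. *)
Lemma defect_ge X s : (0 < k)%N -> col_stochastic X ->
  2 * (k%:R * misplaced X s - misplaced X s ^+ 2
       - (k%:R - 2) * \sum_j (1 - X (s j) j) ^+ 2) <= defect X.
Proof.
move=> k0 SX; have [X0 X1] := SX.
set u := misplaced X s; set Q := \sum_j _.
pose d j := 1 - X (s j) j.
have d0 j : 0 <= d j by rewrite subr_ge0 stochastic_le1.
have k1 : 0 <= k%:R - 1 :> R by rewrite subr_ge0 ler1n.
have colj j : 2 * (d j - d j ^+ 2) <= 1 - \sum_i X i j ^+ 2.
  have := X1 j; rewrite (bigD1 (s j)) //= => e1.
  rewrite (bigD1 (s j) (F := fun i => X i j ^+ 2)) //=.
  have := @sum_sqr_le R _ (fun i => i != s j) (X^~ j) (fun i _ => X0 i j).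
  have -> : \sum_(i | i != s j) X i j = d j by rewrite /d -e1; ring.
  rewrite /d; set T := \sum_(i | _) _; lra.
pose t j := \sum_j' X (s j) j' - X (s j) j.
have tE j : t j = \sum_(j' | j' != j) X (s j) j'.
  by rewrite /t (bigD1 j) //= [X in X - _]addrC addrK.
have t_le j : t j <= u - d j.
  have -> : u - d j = \sum_(j' | j' != j) d j'.
    by rewrite /u /misplaced (bigD1 j) //= [X in X - _]addrC addrK.
  rewrite tE.
  apply: ler_sum => j' j'j; rewrite lerBrDr -[leRHS](X1 j') (bigD1 (s j')) //=.
  rewrite [leLHS]addrC lerD2l (bigD1 (s j)) /=.
    by rewrite lerDl sumr_ge0.
  by rewrite (inj_eq perm_inj) eq_sym.
have sumt : \sum_j t j = u.
  rewrite /t /u /misplaced !sumrB; congr (_ - _).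
  rewrite -(reindex_inj (perm_inj (s := s)) (P := xpredT)
              (F := fun i => \sum_j X i j)) /=.
  by rewrite exchange_big /=; apply: eq_bigr => j _; rewrite X1.
have rowj j : 2 * (1 - d j) * t j
    <= (\sum_j' X (s j) j') ^+ 2 - \sum_j' X (s j) j' ^+ 2.
  have := @sqr_sum_pivot R _ (X (s j)) j (X0 _).
  rewrite /d /t; set a := \sum_j' _; set b := \sum_i _; lra.
have hcol : (k%:R - 1) * (2 * (u - Q))
    <= (k%:R - 1) * \sum_j (1 - \sum_i X i j ^+ 2).
  apply: ler_wpM2l => //; rewrite /u /misplaced /Q -sumrB mulr_sumr.
  by apply: ler_sum => j _; exact: colj.
have hrow : 2 * (u - (u ^+ 2 - Q)) <=
    \sum_i ((\sum_j X i j) ^+ 2 - \sum_j X i j ^+ 2).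
  rewrite (reindex_inj (perm_inj (s := s))) /=.
  apply: le_trans (ler_sum _ (fun j _ => rowj j)).
  have -> : \sum_j 2 * (1 - d j) * t j = 2 * (u - \sum_j d j * t j).
    by rewrite -sumt -sumrB mulr_sumr; apply: eq_bigr => j _; ring.
  rewrite ler_pM2l ?ltr0n // lerD2l lerN2.
  apply: (@le_trans _ _ (\sum_j d j * (u - d j))).
    by apply: ler_sum => j _; rewrite ler_wpM2l.
  rewrite /Q expr2 {1}/u /misplaced mulr_suml -sumrB.
  by apply: ler_sum => j _; rewrite /d mulrBr expr2.
rewrite /defect; lra.
Qed.

Lemma defect_ge_misplaced X s : (2 <= k)%N -> col_stochastic X ->
  2 * misplaced X s * (k%:R - (k%:R - 1) * misplaced X s) <= defect X.
Proof.
move=> k2 SX; apply: le_trans (defect_ge s (ltnW k2) SX).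
have Qu : \sum_j (1 - X (s j) j) ^+ 2 <= misplaced X s ^+ 2.
  by apply: sum_sqr_le => j _; rewrite subr_ge0 stochastic_le1.
have k2' : 2 <= k%:R :> R by rewrite (ler_nat _ 2).
move: Qu; set u := misplaced _ _; set Q := \sum_j _ => Qu.
have : (k%:R - 2) * Q <= (k%:R - 2) * u ^+ 2 by rewrite ler_wpM2l // subr_ge0.
lra.
Qed.

Lemma misplaced_ge0 X s : col_stochastic X -> 0 <= misplaced X s.
Proof. by move=> SX; apply: sumr_ge0 => j _; rewrite subr_ge0 stochastic_le1. Qed.

(** The quadratic of the previous bound is at least 2 for u between
    1 / (k - 1) and 1. *)
Lemma misplaced_lt X s : (2 <= k)%N -> col_stochastic X ->
  defect X < 2 -> misplaced X s <= 1 -> (k%:R - 1) * misplaced X s < 1.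
Proof.
move=> k2 SX D2 u1; have := defect_ge_misplaced s k2 SX.
have k2' : 2 <= k%:R :> R by rewrite (ler_nat _ 2).
set u := misplaced _ _ in u1 *; nra.
Qed.

(** Chord bound for the same quadratic, between u = 0 and u = 1 / (k - 1). *)
Lemma misplaced_le_defect X s : (2 <= k)%N -> col_stochastic X ->
  defect X < 2 -> misplaced X s <= 1 ->
  2 * (k%:R - 1) * misplaced X s <= defect X.
Proof.
move=> k2 SX D2 u1; have := misplaced_lt k2 SX D2 u1.
have := defect_ge_misplaced s k2 SX; have := misplaced_ge0 s SX.
set u := misplaced _ _ in u1 *; nra.
Qed.

End Stochastic.

(** * Rounding to a permutation matrix *)

Section Rounding.
Variables (R : realFieldType) (k : nat).
Implicit Types (X : 'I_k -> 'I_k -> R) (s : 'S_k).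

Definition round_col X (j i0 : 'I_k) : 'I_k -> 'I_k -> R :=
  fun i j' => if j' == j then (i == i0)%:R else X i j'.

Lemma sum_indic (f : 'I_k -> R) i0 : \sum_i (i == i0)%:R * f i = f i0.
Proof.
rewrite (bigD1 i0) //= eqxx mul1r big1 ?addr0 // => i /negbTE->.
by rewrite mul0r.
Qed.

Lemma round_col_stochastic X j i0 :
  col_stochastic X -> col_stochastic (round_col X j i0).
Proof.
move=> [X0 X1]; split=> [i j'|j']; rewrite /round_col; case: eqP => // _.
by rewrite -[RHS](sum_indic (fun=> 1) i0); apply: eq_bigr => i _; rewrite mulr1.
Qed.

(** The defect as a function of column j alone: a concave part and a linear
    part, whose coefficients are the masses of the rows in the other columns. *)
Lemma defect_col X j : defect X =
  (k%:R - 1) * (1 - \sum_i X i j ^+ 2)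
  + 2 * \sum_i X i j * \sum_(j' | j' != j) X i j'
  + ((k%:R - 1) * \sum_(j' | j' != j) (1 - \sum_i X i j' ^+ 2)
     + \sum_i ((\sum_(j' | j' != j) X i j') ^+ 2 - \sum_(j' | j' != j) X i j' ^+ 2)).
Proof.
rewrite /defect (bigD1 j) //= mulrDr -!addrA; congr (_ + _).
rewrite [RHS]addrCA; congr (_ + _); rewrite mulr_sumr -big_split /=.
apply: eq_bigr => i _.
rewrite (bigD1 j) //= (bigD1 j (F := fun j => X i j ^+ 2)) //=; ring.
Qed.

(** Round towards the row in which the other columns have the least mass: this
    does not increase the linear part, and the concave part vanishes at basis
    vectors. *)
Lemma defect_round_col_le X j : (0 < k)%N -> col_stochastic X ->
  exists i0, defect (round_col X j i0) <= defect X.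
Proof.
move=> k0 SX; have [X0 X1] := SX.
pose w i := \sum_(j' | j' != j) X i j'.
case: (@arg_minP _ _ _ j xpredT w isT) => i0 _ wmin.
exists i0; rewrite (defect_col X j) (defect_col (round_col X j i0) j).
have rest i j' : j' != j -> round_col X j i0 i j' = X i j'.
  by rewrite /round_col => /negbTE->.
have colE i : round_col X j i0 i j = (i == i0)%:R by rewrite /round_col eqxx.
apply: lerD; last first.
  rewrite le_eqVlt; apply/orP; left; apply/eqP; congr (_ + _).
    congr (_ * _); apply: eq_bigr => j' j'j; congr (_ - _).
    by apply: eq_bigr => i _; rewrite rest.
  apply: eq_bigr => i _; congr (_ ^+ 2 - _); apply: eq_bigr => j' j'j;
  by rewrite rest.
apply: lerD.
  apply: ler_wpM2l; first by rewrite subr_ge0 ler1n.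
  apply: (@le_trans _ _ 0).
    rewrite subr_le0 (bigD1 i0) //= colE eqxx expr1n lerDl.
    by apply: sumr_ge0 => i _; rewrite sqr_ge0.
  by rewrite subr_ge0 col_sqr_le1.
apply: ler_wpM2l => //.
have -> : \sum_i round_col X j i0 i j * \sum_(j' | j' != j) round_col X j i0 i j'
    = w i0.
  rewrite -(sum_indic w i0); apply: eq_bigr => i _; rewrite colE; congr (_ * _).
  by apply: eq_bigr => j' /rest->.
rewrite -[w i0]mul1r -(X1 j) mulr_suml; apply: ler_sum => i _.
by rewrite ler_wpM2l // wmin.
Qed.

Lemma defect_collision X (i j j' : 'I_k) :
  col_stochastic X -> (0 < k)%N -> j != j' ->
  X i j = 1 -> X i j' = 1 -> 2 <= defect X.
Proof.
move=> SX k0 jj' e e'; have [X0 X1] := SX.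
have hcol : 0 <= (k%:R - 1) * \sum_j (1 - \sum_i X i j ^+ 2).
  apply: mulr_ge0; first by rewrite subr_ge0 ler1n.
  by apply: sumr_ge0 => l _; rewrite subr_ge0 col_sqr_le1.
rewrite /defect -[leLHS]add0r; apply: lerD => //.
rewrite (bigD1 i) //= -[leLHS]addr0; apply: lerD; last first.
  by apply: sumr_ge0 => h _; rewrite subr_ge0; apply: sum_sqr_le.
have := @sqr_sum_pivot R _ (X i) j (X0 i); rewrite e.
have : 1 <= \sum_j X i j - 1.
  rewrite (bigD1 j) //= e [X in X - 1]addrC addrK (bigD1 j') 1?eq_sym //= e' lerDl.
  exact: sumr_ge0.
set S := \sum_j X i j; set T := \sum_j X i j ^+ 2; lra.
Qed.

(** Restoring one rounded column increases the misplaced mass from u to u + s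
    with s at most 1, which could jump from below 1 / (k - 1) to beyond 1, where
    the quadratic bound in terms of u + s alone drops below 2.  The jump is
    excluded by keeping the sum of squares Q, now at most u^2 + s^2. *)
Lemma rounding_step (kappa u s Q : R) : 3 <= kappa -> 0 <= u ->
  (kappa - 1) * u < 1 -> 0 <= s <= 1 -> Q <= u ^+ 2 + s ^+ 2 ->
  kappa * (u + s) - (u + s) ^+ 2 - (kappa - 2) * Q < 1 ->
  (kappa - 1) * (u + s) < 1.
Proof.
move=> k3 u0 ku /andP[s0 s1] hQ h.
have u1 : u < 1 by nra.
have {hQ} h' : kappa * (u + s) - (u + s) ^+ 2 - (kappa - 2) * (u ^+ 2 + s ^+ 2) < 1.
  have : (kappa - 2) * Q <= (kappa - 2) * (u ^+ 2 + s ^+ 2).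
    by rewrite ler_wpM2l // subr_ge0; lra.
  lra.
have [us|us] := leP (u + s) 1.
  have us0 : 0 <= u * s by rewrite mulr_ge0.
  have h2 : 0 < (u + s - 1) * ((kappa - 1) * (u + s) - 1).
    have : 0 <= (kappa - 2) * (u * s) by rewrite mulr_ge0 // subr_ge0; lra.
    nra.
  nra.
(* s lies between 1 - u and 1, and the left-hand side of h' is concave in s
   and at least 1 at both ends. *)
have e0 : 1 <= kappa - 1 - (kappa - 2) * (u ^+ 2 + (1 - u) ^+ 2).
  have : 0 <= (kappa - 2) * (u * (1 - u)) by rewrite !mulr_ge0 //; lra.
  lra.
have e1 : 1 <= kappa * (u + 1) - (u + 1) ^+ 2 - (kappa - 2) * (u ^+ 2 + 1).
  have : (kappa - 1) * u * u <= 1 * u by rewrite ler_wpM2r // ltW.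
  nra.
have : 0 <= (kappa - 1) * ((1 - s) * (s - (1 - u))).
  by rewrite !mulr_ge0 //; lra.
nra.
Qed.

(** Induction on a number m such that all columns from m on are basis vectors. *)
Lemma exists_misplaced_lt_rounding X (m : nat) : (3 <= k)%N ->
  col_stochastic X ->
  (forall j : 'I_k, (m <= j)%N -> exists i0, forall i, X i j = (i == i0)%:R) ->
  defect X < 2 -> exists s, (k%:R - 1) * misplaced X s < 1.
Proof.
move=> k3; have k0 : (0 < k)%N by apply: leq_trans k3.
have k3' : 3 <= k%:R :> R by rewrite (ler_nat _ 3).
elim: m X => [|m IH] X SX Xunit D2; have [X0 X1] := SX.
  have [r rP] := fin_all_exists (fun j => Xunit j (leq0n _)).
  have rinj : injective r.
    move=> j j' rr; apply/eqP/negPn/negP => jj'; move: D2.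
    apply/negP; rewrite -leNgt.
    by apply: (@defect_collision X (r j) j j') => //; rewrite rP ?rr eqxx.
  exists (perm rinj); rewrite /misplaced big1 ?mulr0 // => j _.
  by rewrite permE rP eqxx subrr.
have [mk|mk] := ltnP m k; last first.
  by apply: (IH X) => // j mj; have := leq_trans mk mj; rewrite leqNgt ltn_ord.
pose j0 := Ordinal mk.
have [i0 le0] := defect_round_col_le j0 k0 SX.
have SX' := round_col_stochastic j0 i0 SX.
have [|s us] := IH _ SX' _ (le_lt_trans le0 D2).
  move=> j mj; rewrite /round_col; have [_|jj0] := eqVneq j j0; first by exists i0.
  apply: Xunit; rewrite ltn_neqAle mj andbT eq_sym.
  by apply: contra_neq jj0 => e; apply: val_inj.
exists s.
have uE Z : misplaced Z s = \sum_(j | j != j0) (1 - Z (s j) j) + (1 - Z (s j0) j0).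
  by rewrite /misplaced (bigD1 j0) //= addrC.
have same : \sum_(j | j != j0) (1 - round_col X j0 i0 (s j) j)
    = \sum_(j | j != j0) (1 - X (s j) j).
  by apply: eq_bigr => j /negbTE jj; rewrite /round_col jj.
move: us; rewrite !uE same {1}/round_col eqxx.
set u := \sum_(j | _) _ => us.
have u0 : 0 <= u by apply: sumr_ge0 => j _; rewrite subr_ge0 stochastic_le1.
(* s must send the rounded column to the row it was rounded to, otherwise this
   column alone has misplaced mass 1. *)
have [si|si] := eqVneq (s j0) i0; last first.
  move: us; rewrite (negbTE si) subr0 => us; nra.
move: us; rewrite si eqxx subrr addr0 -{}si => us.
apply: (@rounding_step _ _ _ (\sum_j (1 - X (s j) j) ^+ 2)) => //.
- by apply/andP; split; rewrite ?gerBl ?subr_ge0 ?stochastic_le1.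
- rewrite (bigD1 j0) //= addrC lerD2r; apply: sum_sqr_le => j _.
  by rewrite subr_ge0 stochastic_le1.
by have := defect_ge s k0 SX; rewrite uE -/u; lra.
Qed.
End Rounding.

(** The rounding step needs k >= 3; for k = 2, the two permutations misplace a
    total mass of exactly 2. *)
Lemma exists_misplaced_le1 (R : realFieldType) (k : nat) (X : 'I_k -> 'I_k -> R) :
  (2 <= k)%N -> col_stochastic X -> defect X < 2 ->
  exists s : 'S_k, misplaced X s <= 1.
Proof.
rewrite leq_eqVlt => /orP[/eqP k2|k3] SX D2; last first.
  have [|s us] := exists_misplaced_lt_rounding k3 SX (m := k) _ D2.
    by move=> j; rewrite leqNgt ltn_ord.
  exists s; have := misplaced_ge0 s SX.
  have : 3 <= k%:R :> R by rewrite (ler_nat _ 3).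
  by set u := misplaced _ _ in us *; nra.
subst k; have [_ X1] := SX.
have := X1 ord0; have := X1 (lift ord0 ord0).
rewrite !big_ord_recl !big_ord0 => e1 e0.
have [h|h] := leP (misplaced X 1%g) 1; first by exists 1%g.
exists (tperm ord0 (lift ord0 ord0)); move: h.
rewrite /misplaced !big_ord_recl !big_ord0 !perm1 tpermL tpermR.
lra.
Qed.

Lemma exists_misplaced_le_defect (R : realFieldType) (k : nat)
    (X : 'I_k -> 'I_k -> R) :
  (2 <= k)%N -> col_stochastic X -> defect X < 2 ->
  exists s : 'S_k, 2 * (k%:R - 1) * misplaced X s <= defect X.
Proof.
move=> k2 SX D2; have [s us] := exists_misplaced_le1 k2 SX D2.
by exists s; apply: misplaced_le_defect.
Qed.

(** * Concentration of edge counts *)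

(** From exp (- x) >= 1 - x by inversion. *)
Lemma expR_le_quadratic (R : realType) (x : R) :
  x <= 1 / 2 -> expR x <= 1 + x + 2 * x ^+ 2.
Proof.
move=> x2; have := expR_ge1Dx (- x); have := expRxMexpNx_1 x.
have := expR_gt0 x; set y := expR x; set z := expR (- x) => y0 yz hz.
have h : y * (1 - x) <= 1 by rewrite -[leRHS]yz ler_pM2l.
rewrite -(ler_pM2r (x := 1 - x)); last lra.
apply: le_trans h _.
have H : 0 <= 1 - 2 * x by lra.
have := mulr_ge0 (sqr_ge0 x) H; lra.
Qed.

Section ProductMeasure.
Variables (R : realType) (T : finType) (D : {set T}) (pi : T -> R).
Hypothesis pi01 : forall e, 0 <= pi e <= 1.

Definition subset_weight (E : {set T}) : R :=
  \prod_(e in D) (if e \in E then pi e else 1 - pi e).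

Lemma subset_weight_ge0 E : 0 <= subset_weight E.
Proof.
apply: prodr_ge0 => e _; have /andP[? ?] := pi01 e.
by case: ifP => // _; rewrite subr_ge0.
Qed.

Lemma sum_prod_powerset (f g : T -> R) :
  \sum_(E in powerset D) \prod_(e in D) (if e \in E then f e else g e)
  = \prod_(e in D) (f e + g e).
Proof.
(* Outside D the factor 0 removes every E that is not a subset of D, and the
   factor 1 leaves the others unchanged. *)
pose f' e := if e \in D then f e else 0; pose g' e := if e \in D then g e else 1.
have -> : \prod_(e in D) (f e + g e) = \prod_e (f' e + g' e).
  rewrite [RHS](bigID (mem D)) /= [X in _ * X]big1 ?mulr1; last first.
    by move=> e /negbTE eD; rewrite /f' /g' eD add0r.
  by apply: eq_bigr => e eD; rewrite /f' /g' eD.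
rewrite (@bigA_distr _ _ _ _ _ T f' g') [RHS](bigID (mem (powerset D))) /=.
rewrite [X in _ = _ + X]big1 ?addr0 => [|E]; last first.
  rewrite powersetE => /subsetPn[e eE /negbTE eD].
  by rewrite (bigD1 e) //= eE /f' eD mul0r.
apply: congr_big => // E; rewrite powersetE => /subsetP ED.
rewrite [RHS](bigID (mem D)) /= [X in _ * X]big1 ?mulr1 => [|e eD].
  by apply: eq_bigr => e eD; rewrite /f' /g' eD.
by rewrite /g' (negbTE eD) ifN //; apply: contra eD => /ED.
Qed.

Lemma sum_subset_weight : \sum_(E in powerset D) subset_weight E = 1.
Proof. by rewrite sum_prod_powerset big1 // => e _; rewrite addrC subrK. Qed.

Definition mean_in (B : {set T}) : R := \sum_(e in D | e \in B) pi e.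

(** By independence the exponential moment is a product, each of whose factors
    1 + pi e (exp lam - 1) is bounded by an exponential. *)
Lemma exp_moment_le (lam : R) (B : {set T}) : lam <= 1 / 2 ->
  \sum_(E in powerset D) subset_weight E * expR (lam * #|E :&: B|%:R)
  <= expR ((lam + 2 * lam ^+ 2) * mean_in B).
Proof.
move=> lam2.
pose h e : R := if e \in B then expR lam else 1.
have -> : \sum_(E in powerset D) subset_weight E * expR (lam * #|E :&: B|%:R)
    = \sum_(E in powerset D)
        \prod_(e in D) (if e \in E then pi e * h e else 1 - pi e).
  apply: eq_bigr => E; rewrite powersetE => ED.
  have -> : expR (lam * #|E :&: B|%:R) = \prod_(e in D) (if e \in E then h e else 1).
    rewrite expRM_natr -prodr_const big_mkcond /= [RHS]big_mkcond /=.
    apply: eq_bigr => e _; rewrite inE /h.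
    by have := subsetP ED e; do 3!case: (e \in _) => //; move=> /(_ isT).
  rewrite -big_split /=; apply: eq_bigr => e _.
  by case: (e \in E); rewrite ?mulr1.
rewrite sum_prod_powerset mulr_sumr expR_sum.
rewrite big_mkcondr /=; apply: ler_prod => e _.
have /andP[p0 p1] := pi01 e; rewrite /h; have e0 := expR_gt0 lam.
case: ifP => _; last by rewrite mulr1 addrC subrK ler01 lexx.
apply/andP; split; first by rewrite addr_ge0 ?mulr_ge0 ?subr_ge0 // ltW.
apply: le_trans (expR_ge1Dx _).
have := expR_le_quadratic lam2; set y := expR lam => hy.
have : pi e * y <= pi e * (1 + lam + 2 * lam ^+ 2) by rewrite ler_wpM2l.
lra.
Qed.

(** Markov's inequality for the exponential; a negative lam gives the lower
    tail. *)
Lemma chernoff (lam r : R) (B : {set T}) : lam <= 1 / 2 ->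
  \sum_(E in powerset D | r <= lam * (#|E :&: B|%:R - mean_in B)) subset_weight E
  <= expR (2 * lam ^+ 2 * mean_in B - r).
Proof.
move=> lam2.
apply: (@le_trans _ _ (\sum_(E in powerset D)
    subset_weight E * expR (lam * #|E :&: B|%:R) * expR (- lam * mean_in B - r))).
  rewrite big_mkcondr /=; apply: ler_sum => E _; have w0 := subset_weight_ge0 E.
  rewrite -mulrA -expRD; case: ifP => [h|_]; last by rewrite mulr_ge0 // expR_ge0.
  by apply: ler_peMr => //; rewrite -[leLHS]expR0 ler_expR; lra.
rewrite -mulr_suml.
apply: le_trans (ler_wpM2r (expR_ge0 _) (exp_moment_le B lam2)) _.
by rewrite -expRD ler_expR; lra.
Qed.

Lemma chernoff2 (lam r : R) (B : {set T}) : 0 <= lam <= 1 / 2 ->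
  \sum_(E in powerset D | r < `|#|E :&: B|%:R - mean_in B|) subset_weight E
  <= 2 * expR (2 * lam ^+ 2 * mean_in B - lam * r).
Proof.
case/andP=> lam0 lam2.
have h1 := @chernoff lam (lam * r) B lam2.
have h2 : - lam <= 1 / 2 by lra.
have {}h2 := @chernoff (- lam) (lam * r) B h2.
rewrite mulr_natl mulr2n; rewrite sqrrN in h2.
apply: le_trans (lerD h1 h2).
rewrite !(big_mkcondr _ _ _ (fun E => _ <= _)) /= big_mkcondr /= -big_split /=.
apply: ler_sum => E _; have w0 := subset_weight_ge0 E.
set x := _ - _; case: ifP => [|_]; last by apply: addr_ge0; case: ifP.
rewrite ltr_normr => /orP[|] /ltW h.
  by rewrite ler_wpM2l // -[leLHS]addr0 lerD2l; case: ifP.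
by rewrite mulNr -mulrN (ler_wpM2l lam0 h) lerDr; case: ifP.
Qed.

Lemma union_bound (I : finType) (good : pred {set T}) (bad : I -> pred {set T})
    (beta : R) :
  (forall E : {set T}, E \subset D -> ~~ good E -> exists i, bad i E) ->
  (forall i, \sum_(E in powerset D | bad i E) subset_weight E <= beta) ->
  1 - #|I|%:R * beta <= \sum_(E in powerset D | good E) subset_weight E.
Proof.
move=> gb hb; rewrite lerBlDr -[leLHS]sum_subset_weight (bigID good) /= lerD2l.
apply: (@le_trans _ _ (\sum_i \sum_(E in powerset D | bad i E) subset_weight E)).
  under [leRHS]eq_bigr do rewrite big_mkcondr.
  rewrite exchange_big /= [leLHS]big_mkcondr; apply: ler_sum => E.
  rewrite powersetE => ED.
  have c0 i : 0 <= (if bad i E then subset_weight E else 0).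
    by case: ifP => // _; apply: subset_weight_ge0.
  case: ifP => [/(gb E ED)[i bi]|_]; last exact: sumr_ge0.
  by rewrite (bigD1 i) //= bi lerDl sumr_ge0.
rewrite mulr_natl -sumr_const; apply: ler_sum => i _; exact: hb.
Qed.
End ProductMeasure.

Section Concentration.
Variables (R : realType) (V : finType) (k : nat) (P : {ffun 'I_k -> {set V}}).

Definition mean_edges (p q : R) (S : {set V}) : R :=
  \sum_(e in vpairs V | e \subset S) sbm_edge_prob P p q e.

Lemma sbm_edge_prob_le (p q : R) e : q <= p -> sbm_edge_prob P p q e <= p.
Proof. by rewrite /sbm_edge_prob; case: ifP. Qed.

Lemma card_vpairs_le : 2 * #|vpairs V|%:R <= #|V|%:R ^+ 2 :> R.
Proof.
rewrite /vpairs card_draws bin2 -natrM mulnC muln2 -natrX ler_nat expnS expn1.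
apply: leq_trans (_ : #|V| * #|V|.-1 <= _)%N.
  by rewrite -[leqRHS]odd_double_half leq_addl.
by rewrite leq_mul2l leq_pred orbT.
Qed.

Lemma sbm_edges_concentrate (p q lam r : R) : 0 <= q <= p -> p <= 1 ->
  0 <= lam <= 1 / 2 ->
  1 - 2 ^+ #|V| * (2 * expR (lam ^+ 2 * (p * #|V|%:R ^+ 2) - lam * r))
  <= sbm_prob P p q (fun E =>
       [forall S : {set V}, `|(edges_in E S)%:R - mean_edges p q S| <= r]).
Proof.
case/andP=> q0 qp p1 lam01.
pose pi := sbm_edge_prob P p q.
have pi01 e : 0 <= pi e <= 1.
  by rewrite /pi /sbm_edge_prob; case: ifP => _; apply/andP; split; lra.
pose B (S : {set V}) := [set e : {set V} | e \subset S].
have meanE S : mean_edges p q S = mean_in (vpairs V) pi (B S).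
  by apply: eq_bigl => e; congr andb; rewrite [RHS]inE.
have edgesE (E : {set {set V}}) S : edges_in E S = #|E :&: B S|.
  by rewrite /edges_in; congr #|pred_of_set _|; apply/setP => e; rewrite !inE.
have -> : 2 ^+ #|V| = #|{set V}|%:R :> R.
  by rewrite -natrX -[in LHS]cardsT -card_powerset powersetT cardsT.
apply: (@union_bound R _ (vpairs V) pi pi01 {set V} _
   (fun S E => r < `|#|E :&: B S|%:R - mean_in (vpairs V) pi (B S)|)).
  move=> E _ /forallPn[S]; rewrite -ltNge => h; exists S.
  by rewrite -edgesE -meanE.
move=> S; apply: le_trans (chernoff2 _ pi01 _ _ lam01) _.
rewrite ler_pM2l // ler_expR lerD2r [2 * _]mulrC -mulrA.
apply: ler_wpM2l; first exact: sqr_ge0.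
apply: (@le_trans _ _ (2 * (#|vpairs V|%:R * p))).
  rewrite ler_pM2l // /mean_in mulr_natl -sumr_const big_mkcondr /=.
  apply: ler_sum => e _; case: ifP => _; first exact: sbm_edge_prob_le.
  exact: le_trans qp.
by rewrite mulrA mulrC ler_wpM2l ?card_vpairs_le // (le_trans q0).
Qed.

Lemma sbm_prob_mono (p q : R) (e1 e2 : pred {set {set V}}) : 0 <= q <= p -> p <= 1 ->
  (forall E : {set {set V}}, E \subset vpairs V -> e1 E -> e2 E) ->
  sbm_prob P p q e1 <= sbm_prob P p q e2.
Proof.
case/andP=> q0 qp p1 e12; rewrite /sbm_prob big_mkcondr [leRHS]big_mkcondr /=.
apply: ler_sum => E; rewrite powersetE => ED.
have w0 : 0 <= subset_weight (vpairs V) (sbm_edge_prob P p q) E.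
  apply: subset_weight_ge0 => e.
  by rewrite /sbm_edge_prob; case: ifP => _; apply/andP; split; lra.
by case: ifP => [/(e12 E ED)->//|_]; case: ifP.
Qed.
End Concentration.

(** * Expected edge counts, volumes and modularity *)

Lemma sum_mem_setI (T : finType) (S A : {set T}) :
  (\sum_(x in S) (x \in A) = #|S :&: A|)%N.
Proof.
rewrite -sum1_card big_mkcond [RHS]big_mkcond /=; apply: eq_bigr => x _.
by rewrite inE; case: (x \in S); case: (x \in A).
Qed.

Section Pairs.
Variables (R : realType) (V : finType).

(** Each edge comes from two ordered pairs of vertices. *)
Lemma sum_vpairs (g : {set V} -> R) (S : {set V}) :
  \sum_(x in S) \sum_(y in S | y != x) g [set x; y]
  = 2 * \sum_(e in vpairs V | e \subset S) g e.
Proof.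
rewrite pair_big_dep /=.
rewrite (partition_big (fun z : V * V => [set z.1; z.2])
          (fun e => (e \in vpairs V) && (e \subset S))) /=; last first.
  move=> [x y] /= /and3P[xS yS yx]; rewrite inE cards2 [x == y]eq_sym yx /=.
  by rewrite subUset !sub1set xS.
rewrite mulr_sumr; apply: eq_bigr => e /andP[].
rewrite inE => /cards2P[x [y [xy ->]]]; rewrite subUset !sub1set => /andP[xS yS].
rewrite (eq_bigl (mem [set (x, y); (y, x)])) => [|[u v]] /=; last first.
  rewrite !inE !xpair_eqE /=; apply/idP/idP.
    case/andP=> /and3P[_ _ vu] /eqP E.
    have : u \in [set x; y] by rewrite -E set21.
    have : v \in [set x; y] by rewrite -E set22.
    rewrite !inE => /orP[] /eqP ev /orP[] /eqP eu; subst u v.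
    - by rewrite eqxx in vu.
    - by rewrite !eqxx orbT.
    - by rewrite !eqxx.
    - by rewrite eqxx in vu.
  case/orP=> /andP[/eqP-> /eqP->]; first by rewrite xS yS eq_sym xy eqxx.
  by rewrite xS yS xy [X in X == _]setUC eqxx.
rewrite big_setU1 /=; last by rewrite inE xpair_eqE negb_and xy.
by rewrite big_set1 /= [[set y; x]]setUC; ring.
Qed.
End Pairs.

Section Blocks.
Variables (R : realType) (V : finType) (k : nat) (P : {ffun 'I_k -> {set V}}).
Hypothesis kP : kpartition P.

Lemma kpartition_uniq x i j : x \in P i -> x \in P j -> i = j.
Proof.
move=> xi xj; apply/eqP/negPn/negP => ij.
case/andP: kP => /forallP/(_ i)/forallP/(_ j); rewrite ij /= => /pred0P/(_ x).
by rewrite /= xi xj.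
Qed.

Lemma kpartition_cover x : exists i, x \in P i.
Proof.
case/andP: kP => _ /eqP cov; have : x \in [set: V] by rewrite inE.
by rewrite -cov => /bigcupP[i _ xi]; exists i.
Qed.

Lemma sum_same_block x y :
  \sum_j (x \in P j)%:R * (y \in P j)%:R
  = [exists i, [set x; y] \subset P i]%:R :> R.
Proof.
have [/existsP[i]|/existsPn nP] := boolP [exists i, [set x; y] \subset P i].
  rewrite subUset !sub1set => /andP[xi yi].
  rewrite (bigD1 i) //= xi yi mulr1 big1 ?addr0 // => j ji.
  have [xj|] := boolP (x \in P j); last by rewrite mul0r.
  by rewrite (kpartition_uniq xj xi) eqxx in ji.
rewrite big1 // => j _; have := nP j; rewrite subUset !sub1set.
by case: (x \in _); case: (y \in _); rewrite ?mul0r ?mulr0.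
Qed.

Lemma sum_card_blocks (S : {set V}) : (\sum_j #|S :&: P j|)%N = #|S|.
Proof.
transitivity (\sum_(x in S) \sum_j (x \in P j))%N.
  by rewrite exchange_big /=; apply: eq_bigr => j _; rewrite sum_mem_setI.
rewrite -sum1_card; apply: eq_bigr => x _; have [i xi] := kpartition_cover x.
rewrite (bigD1 i) //= xi big1 // => j ji; apply/eqP; rewrite eqb0.
by apply: contra ji => xj; rewrite (kpartition_uniq xj xi).
Qed.

(** The connection probability of x and y is q, plus p - q if they share a block;
    the last term removes the diagonal pairs x = y. *)
Lemma mean_edgesE (p q : R) (S : {set V}) :
  2 * mean_edges P p q S =
  q * #|S|%:R ^+ 2 + (p - q) * \sum_j #|S :&: P j|%:R ^+ 2 - p * #|S|%:R.
Proof.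
pose G x y : R := q + (p - q) * \sum_j (x \in P j)%:R * (y \in P j)%:R.
have GE x y : sbm_edge_prob P p q [set x; y] = G x y.
  by rewrite /G sum_same_block /sbm_edge_prob; case: [exists i, _] => /=; ring.
have GD x : G x x = p.
  rewrite -GE /sbm_edge_prob ifT //; apply/existsP.
  have [i xi] := kpartition_cover x; exists i.
  by rewrite subUset !sub1set xi.
rewrite /mean_edges -sum_vpairs.
have -> : \sum_(x in S) \sum_(y in S | y != x) sbm_edge_prob P p q [set x; y]
    = \sum_(x in S) (\sum_(y in S) G x y - p).
  apply: eq_bigr => x xS; rewrite (bigD1 x (F := G x)) //= GD addrC addrK.
  by apply: eq_bigr => y _; rewrite GE.
rewrite sumrB sumr_const -[X in _ - X]mulr_natr; congr (_ - _).
transitivity (\sum_(x in S) (q * #|S|%:R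
    + (p - q) * \sum_j (x \in P j)%:R * #|S :&: P j|%:R)).
  apply: eq_bigr => x xS.
  rewrite /G big_split /= sumr_const mulr_natr; congr (_ + _).
  rewrite -mulr_sumr exchange_big /=; congr (_ * _); apply: eq_bigr => j _.
  rewrite -mulr_sumr; congr (_ * _).
  by rewrite -sum_mem_setI natr_sum.
rewrite big_split /= sumr_const -[X in X + _]mulr_natr -mulrA -expr2; congr (_ + _).
rewrite -mulr_sumr exchange_big /=; congr (_ * _); apply: eq_bigr => j _.
rewrite -mulr_suml expr2; congr (_ * _).
by rewrite -sum_mem_setI natr_sum.
Qed.

End Blocks.

Section Graph.
Variables (V : finType) (E : {set {set V}}).
Hypothesis EV : E \subset vpairs V.

Lemma edge_card e : e \in E -> #|e| = 2.
Proof. by move/(subsetP EV); rewrite inE => /eqP. Qed.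

Lemma edges_in_sum S : edges_in E S = (\sum_(e in E) (e \subset S))%N.
Proof.
rewrite /edges_in -sum1_card big_mkcond [RHS]big_mkcond /=.
by apply: eq_bigr => e _; rewrite inE; case: (e \in E); case: (e \subset S).
Qed.

Lemma edges_in_setT : edges_in E [set: V] = #|E|.
Proof.
by rewrite edges_in_sum -sum1_card; apply: eq_bigr => e _; rewrite subsetT.
Qed.

Lemma edges_in_set0 : edges_in E set0 = 0%N.
Proof.
rewrite edges_in_sum big1 // => e /edge_card e2; rewrite subset0.
by case: eqP => // e0; rewrite e0 cards0 in e2.
Qed.

Lemma edges_in_le S : (edges_in E S <= #|E|)%N.
Proof.
rewrite -edges_in_setT !edges_in_sum leq_sum // => e _.
by rewrite subsetT leq_b1.
Qed.

(** An edge e contributes |e /\ S| to the volume of S, and this is 1, plus 1 if e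
    lies inside S, minus 1 if e lies inside the complement. *)
Lemma volE S : (vol E S + edges_in E (~: S) = #|E| + edges_in E S)%N.
Proof.
have -> : vol E S = (\sum_(e in E) #|e :&: S|)%N.
  transitivity (\sum_(v in S) \sum_(e in E) (v \in e))%N.
    apply: eq_bigr => v _; rewrite /degree -sum1_card big_mkcond [RHS]big_mkcond /=.
    by apply: eq_bigr => e _; rewrite inE; case: (e \in E); case: (v \in e).
  by rewrite exchange_big /=; apply: eq_bigr => e _; rewrite sum_mem_setI setIC.
rewrite !edges_in_sum -[#|E|]sum1_card -!big_split /=.
apply: eq_bigr => e /edge_card/eqP/cards2P[x [y [xy ->]]].
rewrite !subUset !sub1set !inE.
rewrite setIUl cardsU -setIIl.
have -> : [set x] :&: [set y] = set0.
  apply/setP => z; rewrite !inE; apply/negP => /andP[/eqP-> /eqP e'].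
  by rewrite e' eqxx in xy.
rewrite set0I cards0 subn0.
have c z : #|[set z] :&: S| = (z \in S).
  have [zS|zS] := boolP (z \in S); first by rewrite (setIidPl _) ?sub1set ?cards1.
  by apply/eqP; rewrite cards_eq0 setI_eq0 disjoints1.
by rewrite !c; case: (x \in S); case: (y \in S).
Qed.

Lemma vol_setT : vol E [set: V] = (2 * #|E|)%N.
Proof.
have := volE [set: V]; rewrite setCT edges_in_set0 edges_in_setT addn0 => ->.
by rewrite mul2n addnn.
Qed.

Lemma vol_set0 : vol E set0 = 0%N.
Proof. by rewrite /vol big_set0. Qed.

End Graph.

Section Parts.
Variables (R : realType) (V : finType) (k : nat) (A : {ffun 'I_k -> {set V}}).
Hypothesis kA : kpartition A.

(** Only nonempty parts are pairwise distinct, whence the condition on f. *)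
Lemma sum_parts (f : {set V} -> R) : f set0 = 0 ->
  \sum_(S in parts A) f S = \sum_i f (A i).
Proof.
move=> f0; rewrite (bigID (pred1 set0)) [RHS](bigID (fun i => A i == set0)) /=.
rewrite [X in X + _ = _]big1 ?add0r; last by move=> S /andP[_ /eqP->].
rewrite [X in _ = X + _]big1 ?add0r; last by move=> i /eqP->.
rewrite -(@big_imset _ _ _ _ _ A (fun i => A i != set0) f) /=.
  apply: eq_bigl => S; apply/andP/imsetP.
    by case=> /imsetP[i _ ->] h; exists i.
  by case=> i h ->; split=> //; apply: imset_f.
move=> i j /set0Pn[x xi] _ e; apply: (kpartition_uniq kA xi).
by rewrite -e.
Qed.

Lemma modularity_parts (E : {set {set V}}) : E \subset vpairs V ->
  modularity R E (parts A) =
  \sum_i ((edges_in E (A i))%:R / #|E|%:R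
          - ((vol E (A i))%:R / (2 * #|E|%:R)) ^+ 2).
Proof.
move=> EV; rewrite /modularity vol_setT // natrM !sum_parts ?sumrB //.
  by rewrite vol_set0 mul0r expr0n.
by rewrite edges_in_set0 // mul0r.
Qed.

Lemma modularity_parts_le (E : {set {set V}}) : (forall i, A i != set0) ->
  modularity R E (parts A) <= max_modularity R E.
Proof.
move=> A0; apply: (le_bigmax_cond _ (fun PA => modularity R E PA)).
case/andP: (kA) => _ /eqP cov; apply/and3P; split.
- rewrite /cover -cov; apply/eqP/setP => x; apply/bigcupP/bigcupP.
    by case=> S /imsetP[i _ ->] xi; exists i.
  by case=> i _ xi; exists (A i) => //; apply: imset_f.
- apply/trivIsetP => S S' /imsetP[i _ ->] /imsetP[j _ ->] ij.
  apply/pred0P => x; apply/negP => /andP[/= xi xj]; move: ij.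
  by rewrite (kpartition_uniq kA xi xj) eqxx.
by apply/imsetP => -[i _ e]; have := A0 i; rewrite -e eqxx.
Qed.
End Parts.

(** * Edge densities of vertex sets *)

Section Perturbation.
Variable R : realFieldType.
Implicit Types x y m e h H eta : R.

Lemma sqr_close x y eta : 0 <= x <= 1 -> 0 <= y <= 1 -> `|x - y| <= eta ->
  `|x ^+ 2 - y ^+ 2| <= 2 * eta.
Proof.
move=> /andP[x0 x1] /andP[y0 y1] h.
have -> : x ^+ 2 - y ^+ 2 = (x + y) * (x - y) by ring.
rewrite normrM; apply: ler_pM => //.
by rewrite ger0_norm ?addr_ge0 //; lra.
Qed.

Lemma ratio_close m e h H eta : 0 < m -> 0 < H -> 0 <= e <= m ->
  `|m - H| <= eta -> `|e - h| <= eta -> `|e / m - h / H| <= 2 * eta / H.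
Proof.
move=> m0 H0 /andP[e0 em] mH eh.
have -> : e / m - h / H = ((e / m) * (H - m) + (e - h)) / H.
  by field; rewrite !gt_eqF.
rewrite normrM [`|H^-1|]gtr0_norm ?invr_gt0 // ler_pM2r ?invr_gt0 //.
apply: le_trans (ler_normD _ _) _; rewrite mulrDl mul1r; apply: lerD => //.
rewrite normrM distrC -[leRHS]mul1r; apply: ler_pM => //.
by rewrite ger0_norm ?(ler_pdivrMr _ _ m0) ?mul1r // divr_ge0 // ltW.
Qed.

End Perturbation.

Section Profile.
Variables (R : realType) (V : finType) (k : nat) (P : {ffun 'I_k -> {set V}}).
Hypotheses (k_gt0 : (0 < k)%N) (kP : kpartition P) (bP : balanced P).
Hypothesis kV : (k <= #|V|)%N.
Implicit Types S : {set V}.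

Local Notation N := (#|V|%:R : R).

Definition fraction S j : R := #|S :&: P j|%:R / #|P j|%:R.

Let k0 : 0 < k%:R :> R. Proof. by rewrite ltr0n. Qed.
Let N0 : 0 < N. Proof. by rewrite ltr0n (leq_trans k_gt0). Qed.

Lemma block_gt0 j : (0 < #|P j|)%N.
Proof.
have /andP[h _] := forallP bP j; apply: leq_trans h.
by rewrite divn_gt0.
Qed.

Lemma block_size j : `|#|P j|%:R / N - k%:R^-1| <= N^-1.
Proof.
have /andP[h1 h2] := forallP bP j.
have h3 : (#|P j| * k <= #|V| + k)%N.
  apply: (@leq_trans (#|V| + k.-1)); last by rewrite leq_add2l leq_pred.
  by apply: leq_trans (leq_trunc_div _ k); rewrite leq_mul2r h2 orbT.
have h4 : (#|V| <= #|P j| * k + k)%N.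
  apply: (leq_trans (ltnW (ltn_ceil #|V| k_gt0))).
  by rewrite -mulSnr leq_mul2r ltnS h1 orbT.
move: h3 h4; rewrite -!(ler_nat R) !natrD !natrM => h3 h4.
have -> : #|P j|%:R / N - k%:R^-1 = (#|P j|%:R * k%:R - N) / k%:R / N.
  by field; rewrite !gt_eqF.
rewrite normrM [`|N^-1|]gtr0_norm ?invr_gt0 // ler_piMl ?invr_ge0 ?(ltW N0) //.
rewrite normrM [`|k%:R^-1|]gtr0_norm ?invr_gt0 // ler_pdivrMr // mul1r.
by rewrite ler_norml; apply/andP; split; lra.
Qed.

Lemma fraction_bounds S j : 0 <= fraction S j <= 1.
Proof.
have p0 : 0 < #|P j|%:R :> R by rewrite ltr0n block_gt0.
rewrite /fraction divr_ge0 // ler_pdivrMr // mul1r ler_nat.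
by rewrite subset_leq_card ?subsetIr.
Qed.

Lemma fraction_setC S j : fraction (~: S) j = 1 - fraction S j.
Proof.
have p0 : 0 < #|P j|%:R :> R by rewrite ltr0n block_gt0.
apply/eqP; rewrite eq_sym subr_eq -mulrDl -natrD addnC.
rewrite ![_ :&: P j]setIC -setDE cardsID divff // gt_eqF //.
Qed.

Lemma fraction_setT j : fraction [set: V] j = 1.
Proof.
rewrite /fraction setTI divff // pnatr_eq0 -lt0n; exact: block_gt0.
Qed.

Lemma sum_fraction_bounds S : 0 <= (\sum_j fraction S j) / k%:R <= 1.
Proof.
apply/andP; split.
  by apply: divr_ge0 => //; apply: sumr_ge0 => j _; case/andP: (fraction_bounds S j).
rewrite ler_pdivrMr // mul1r -[X in _ <= X%:R]card_ord -sumr_const.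
by apply: ler_sum => j _; case/andP: (fraction_bounds S j).
Qed.

Lemma card_close S j :
  `|#|S :&: P j|%:R / N - fraction S j / k%:R| <= N^-1.
Proof.
have p0 : 0 < #|P j|%:R :> R by rewrite ltr0n block_gt0.
have -> : #|S :&: P j|%:R / N - fraction S j / k%:R
    = fraction S j * (#|P j|%:R / N - k%:R^-1).
  by rewrite /fraction; field; rewrite !gt_eqF.
rewrite normrM -[leRHS]mul1r; have /andP[f0 f1] := fraction_bounds S j.
apply: ler_pM => //; last exact: block_size.
by rewrite ger0_norm.
Qed.

Lemma volume_close S :
  `|#|S|%:R / N - (\sum_j fraction S j) / k%:R| <= k%:R / N.
Proof.
rewrite -(sum_card_blocks kP S) natr_sum !mulr_suml -sumrB.
apply: le_trans (ler_norm_sum _ _ _) _.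
apply: le_trans (ler_sum _ (fun j _ => card_close S j)) _.
by rewrite sumr_const card_ord mulr_natl.
Qed.

(** The limit of the expected number of edges inside S divided by omega n, for
    blocks of size exactly n / k. *)
Definition edge_density (a b : R) S : R :=
  (b * ((\sum_j fraction S j) / k%:R) ^+ 2
   + (a - b) * \sum_j (fraction S j / k%:R) ^+ 2) / 2.

Lemma mean_edges_close (a b omega : R) S : 0 < b -> b < a -> 0 < omega ->
  `|mean_edges P (omega * a / N) (omega * b / N) S / (omega * N)
    - edge_density a b S| <= (k%:R + 1) * a / N.
Proof.
move=> b0 ba o0; have SV : (#|S| <= #|V|)%N by rewrite max_card.
have inv1 T : 0 <= #|(T : {set V})|%:R / N <= 1.
  by rewrite divr_ge0 // ler_pdivrMr // mul1r ler_nat max_card.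
have fr j : 0 <= fraction S j / k%:R <= 1.
  have /andP[f0 f1] := fraction_bounds S j; rewrite divr_ge0 // ler_pdivrMr // mul1r.
  by apply: le_trans f1 _; rewrite ler1n.
have -> : mean_edges P (omega * a / N) (omega * b / N) S / (omega * N) =
    (b * (#|S|%:R / N) ^+ 2 + (a - b) * \sum_j (#|S :&: P j|%:R / N) ^+ 2
     - a / N * (#|S|%:R / N)) / 2.
  have := mean_edgesE kP (omega * a / N) (omega * b / N) S.
  have -> : \sum_j (#|S :&: P j|%:R / N) ^+ 2
      = (\sum_j #|S :&: P j|%:R ^+ 2) / N ^+ 2.
    by rewrite mulr_suml; apply: eq_bigr => j _; rewrite expr_div_n.
  set M := mean_edges _ _ _ _; set s2 := \sum_j _; set s := #|S|%:R => ME.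
  have -> : M = (2 * M) / 2 by field.
  by rewrite ME; field; rewrite !gt_eqF.
rewrite /edge_density.
set s := #|S|%:R / N; set y := (\sum_j _) / _.
set x2 := \sum_j _; set f2 := \sum_j _.
have h1 : `|s ^+ 2 - y ^+ 2| <= 2 * (k%:R / N).
  apply: sqr_close; [exact: inv1|exact: sum_fraction_bounds|exact: volume_close].
have h2 : `|x2 - f2| <= 2 * (k%:R / N).
  rewrite /x2 /f2 -sumrB; apply: le_trans (ler_norm_sum _ _ _) _.
  have -> : 2 * (k%:R / N) = \sum_(j < k) 2 * N^-1.
    by rewrite sumr_const card_ord -mulr_natl; ring.
  apply: ler_sum => j _; apply: sqr_close; [exact: inv1|exact: fr|exact: card_close].
have h3 : 0 <= a / N * s <= a / N.
  have a0 : 0 <= a / N by rewrite divr_ge0 // ltW // (lt_trans b0).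
  by have /andP[s0 s1] := inv1 S; rewrite mulr_ge0 // ler_piMr.
have -> : (k%:R + 1) * a / N = k%:R / N * a + a / N by ring.
move: h1 h2 h3; set c := k%:R / N; set aN := a / N.
set t := aN * s; rewrite !ler_norml => /andP[h1 h1'] /andP[h2 h2'] /andP[h3 h3'].
have g1 : b * (s ^+ 2 - y ^+ 2) <= b * (2 * c) by rewrite ler_wpM2l // ltW.
have g1' : b * (- (2 * c)) <= b * (s ^+ 2 - y ^+ 2) by rewrite ler_wpM2l // ltW.
have ab0 : 0 <= a - b by rewrite subr_ge0 ltW.
have g2 : (a - b) * (x2 - f2) <= (a - b) * (2 * c) by rewrite ler_wpM2l.
have g2' : (a - b) * (- (2 * c)) <= (a - b) * (x2 - f2) by rewrite ler_wpM2l.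
apply/andP; split; lra.
Qed.

End Profile.

(** * Modularity of a partition against its overlap matrix *)

Section Stability.
Variables (R : realType) (V : finType) (k : nat) (P : {ffun 'I_k -> {set V}}).
Hypotheses (k_ge2 : (2 <= k)%N) (kP : kpartition P) (bP : balanced P).
Hypothesis kV : (k <= #|V|)%N.
Variables (a b : R).
Hypotheses (b_gt0 : 0 < b) (b_lt_a : b < a).

Let k_gt0 : (0 < k)%N := ltnW k_ge2.
Let k0 : 0 < k%:R :> R. Proof. by rewrite ltr0n. Qed.
Let k2 : 2 <= k%:R :> R. Proof. by rewrite (ler_nat _ 2). Qed.
Local Notation N := (#|V|%:R : R).
Let N0 : 0 < N. Proof. by rewrite ltr0n (leq_trans k_gt0). Qed.
Local Notation D := (a + (k%:R - 1) * b).
Let D0 : 0 < D. Proof.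
apply: addr_gt0; first exact: lt_trans b_lt_a.
by rewrite mulr_gt0 // subr_gt0 ltr1n.
Qed.

Definition profile (A : {ffun 'I_k -> {set V}}) : 'I_k -> 'I_k -> R :=
  fun i j => fraction R P (A i) j.

Lemma profile_stochastic A : kpartition A -> col_stochastic (profile A).
Proof.
move=> kA; split=> [i j|j].
  by case/andP: (fraction_bounds R k_gt0 bP kV (A i) j).
rewrite /profile /fraction -mulr_suml -natr_sum.
under eq_bigr do rewrite setIC.
rewrite (sum_card_blocks kA) divff // pnatr_eq0 -lt0n.
exact: (block_gt0 k_gt0 bP kV).
Qed.

Lemma profile_planted i j : profile P i j = (i == j)%:R.
Proof.
rewrite /profile /fraction; have [->|ij] := eqVneq i j.
  by rewrite setIid divff // pnatr_eq0 -lt0n (block_gt0 k_gt0 bP kV).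
suff -> : P i :&: P j = set0 by rewrite cards0 mul0r.
apply/setP => x; rewrite !inE; apply/negP => /andP[xi xj].
by rewrite (kpartition_uniq kP xi xj) eqxx in ij.
Qed.

Lemma defect_planted : defect (profile P) = 0.
Proof.
rewrite /defect big1 ?mulr0 ?add0r => [|j _].
  rewrite big1 // => i _.
  under eq_bigr do rewrite profile_planted.
  rewrite (bigD1 i) //= eqxx big1 ?addr0 => [|j /negbTE]; last first.
    by rewrite eq_sym => ->.
  rewrite (bigD1 i) //= profile_planted eqxx big1 ?addr0 ?subrr // => j /negbTE ji.
  by rewrite profile_planted eq_sym ji expr0n.
rewrite (bigD1 j) //= profile_planted eqxx big1 ?addr0 ?expr1n ?subrr //.
move=> i /negbTE ij.
by rewrite profile_planted ij expr0n.
Qed.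

Definition limit_modularity (X : 'I_k -> 'I_k -> R) : R :=
  (a - b) / (D * k%:R ^+ 2) * (k%:R ^+ 2 - k%:R - defect X).

Lemma limit_modularityE (A : {ffun 'I_k -> {set V}}) :
  \sum_i (edge_density P a b (A i) / (D / (2 * k%:R))
          - ((\sum_j fraction R P (A i) j) / k%:R) ^+ 2)
  = limit_modularity (profile A).
Proof.
rewrite /limit_modularity /defect -/(profile A).
pose Y i : R := \sum_j profile A i j.
pose Q i : R := \sum_j profile A i j ^+ 2.
have -> : \sum_j (1 - \sum_i profile A i j ^+ 2) = k%:R - \sum_i Q i.
  by rewrite sumrB sumr_const card_ord exchange_big.
have -> : \sum_i ((\sum_j profile A i j) ^+ 2 - \sum_j profile A i j ^+ 2)
    = \sum_i Y i ^+ 2 - \sum_i Q i by rewrite sumrB.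
have -> : (a - b) / (D * k%:R ^+ 2)
     * (k%:R ^+ 2 - k%:R - ((k%:R - 1) * (k%:R - \sum_i Q i)
                            + (\sum_i Y i ^+ 2 - \sum_i Q i)))
  = (a - b) / (D * k%:R) * (\sum_i Q i)
    - (a - b) / (D * k%:R ^+ 2) * \sum_i Y i ^+ 2.
  by field; rewrite !gt_eqF.
rewrite !mulr_sumr -sumrB; apply: eq_bigr => i _.
have -> : edge_density P a b (A i)
    = (b * (Y i / k%:R) ^+ 2 + (a - b) * (Q i / k%:R ^+ 2)) / 2.
  rewrite /edge_density; congr ((_ + _ * _) / 2).
  by rewrite mulr_suml; apply: eq_bigr => j _; rewrite expr_div_n.
rewrite -/(Y i); field; by rewrite !gt_eqF.
Qed.

Lemma edge_density_setT : edge_density P a b [set: V] = D / (2 * k%:R).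
Proof.
rewrite /edge_density.
under eq_bigr do rewrite (fraction_setT R k_gt0 bP kV).
under [X in _ + _ * X]eq_bigr do rewrite (fraction_setT R k_gt0 bP kV).
rewrite !sumr_const card_ord -[_ *+ k]mulr_natr; field; by rewrite gt_eqF.
Qed.

(** In the limit, the volume of S is proportional to its size. *)
Lemma edge_density_setC S :
  edge_density P a b S - edge_density P a b (~: S)
  = (2 * ((\sum_j fraction R P S j) / k%:R) - 1) * (D / (2 * k%:R)).
Proof.
rewrite /edge_density.
have -> : \sum_j fraction R P (~: S) j = k%:R - \sum_j fraction R P S j.
  under eq_bigr do rewrite (fraction_setC R k_gt0 bP kV).
  by rewrite sumrB sumr_const card_ord.
have -> : \sum_j (fraction R P (~: S) j / k%:R) ^+ 2
    = k%:R^-1 - 2 * (\sum_j fraction R P S j) / k%:R ^+ 2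
      + \sum_j (fraction R P S j / k%:R) ^+ 2.
  have kE : k%:R^-1 = \sum_(j < k) (k%:R^-1) ^+ 2 :> R.
    by rewrite sumr_const card_ord -[RHS]mulr_natr; field; by rewrite gt_eqF.
  rewrite [X in _ = X - _ + _]kE mulr_sumr mulr_suml -sumrB -big_split /=.
  apply: eq_bigr => j _.
  by rewrite (fraction_setC R k_gt0 bP kV); field; by rewrite gt_eqF.
by field; rewrite !gt_eqF.
Qed.

Variables (omega eta : R) (E : {set {set V}}).
Hypotheses (omega_gt0 : 0 < omega) (EV : E \subset vpairs V).
Hypothesis eta_lt : eta < D / (2 * k%:R).
Hypothesis edges_close : forall S,
  `|(edges_in E S)%:R / (omega * N) - edge_density P a b S| <= eta.

Lemma edges_gt0 : 0 < #|E|%:R :> R.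
Proof.
have := edges_close [set: V]; rewrite edge_density_setT edges_in_setT //.
rewrite ler_norml => /andP[h _].
have : 0 < #|E|%:R / (omega * N) by move: h eta_lt; set H := D / _; lra.
by rewrite pmulr_lgt0 // invr_gt0 mulr_gt0.
Qed.

Lemma edge_fraction_close S :
  `|(edges_in E S)%:R / #|E|%:R - edge_density P a b S / (D / (2 * k%:R))|
  <= 2 * eta / (D / (2 * k%:R)).
Proof.
have m0 := edges_gt0; have oN : 0 < omega * N by rewrite mulr_gt0.
have -> : (edges_in E S)%:R / #|E|%:R
    = ((edges_in E S)%:R / (omega * N)) / (#|E|%:R / (omega * N)) :> R.
  by field; rewrite !gt_eqF.
apply: ratio_close => //.
- by rewrite divr_gt0.
- by rewrite divr_gt0 // mulr_gt0.
- rewrite divr_ge0 ?(ltW oN) //= ler_pM2r ?invr_gt0 // ler_nat; exact: edges_in_le.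
by have := edges_close [set: V]; rewrite edge_density_setT edges_in_setT.
Qed.

Lemma volume_fraction_close S :
  `|((vol E S)%:R / (2 * #|E|%:R)) ^+ 2 - ((\sum_j fraction R P S j) / k%:R) ^+ 2|
  <= 2 * (2 * eta / (D / (2 * k%:R))).
Proof.
have m0 := edges_gt0.
have fr T : 0 <= ((edges_in E T)%:R / #|E|%:R : R) <= 1.
  by rewrite divr_ge0 // ler_pdivrMr // mul1r ler_nat edges_in_le.
have -> : (vol E S)%:R / (2 * #|E|%:R)
    = (1 + (edges_in E S)%:R / #|E|%:R - (edges_in E (~: S))%:R / #|E|%:R) / 2 :> R.
  have -> : (vol E S)%:R = #|E|%:R + (edges_in E S)%:R - (edges_in E (~: S))%:R :> R.
    by rewrite -natrD -(volE EV S) natrD addrK.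
  by field; rewrite gt_eqF.
have h1 := edge_fraction_close S; have h2 := edge_fraction_close (~: S).
have hS := edge_density_setC S.
have H0 : 0 < D / (2 * k%:R) by rewrite divr_gt0 // mulr_gt0.
have {}hS : edge_density P a b S / (D / (2 * k%:R))
   - edge_density P a b (~: S) / (D / (2 * k%:R))
   = 2 * ((\sum_j fraction R P S j) / k%:R) - 1.
  by rewrite -mulrBl hS mulfK // gt_eqF.
apply: sqr_close.
- by have /andP[? ?] := fr S; have /andP[? ?] := fr (~: S); apply/andP; split; lra.
- exact: (sum_fraction_bounds R k_gt0 bP kV S).
move: h1 h2 hS; set K := 2 * eta / _.
set x := _ / #|E|%:R; set x' := _ / #|E|%:R.
set z := _ / (D / _); set z' := _ / (D / _).
set y := (\sum_j _) / _.
rewrite !ler_norml => /andP[? ?] /andP[? ?] ?; apply/andP; split; lra.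
Qed.

Lemma modularity_close (A : {ffun 'I_k -> {set V}}) : kpartition A ->
  `|modularity R E (parts A) - limit_modularity (profile A)|
  <= 12 * k%:R ^+ 2 * eta / D.
Proof.
move=> kA; rewrite modularity_parts // -limit_modularityE -sumrB.
apply: le_trans (ler_norm_sum _ _ _) _.
have -> : 12 * k%:R ^+ 2 * eta / D = \sum_(i < k) 3 * (2 * eta / (D / (2 * k%:R))).
  by rewrite sumr_const card_ord -[RHS]mulr_natr; field; rewrite !gt_eqF.
apply: ler_sum => i _; have := edge_fraction_close (A i).
have := volume_fraction_close (A i).
set K := 2 * eta / _; set x := _ ^+ 2; set x' := _ ^+ 2.
set z := _ / #|E|%:R; set z' := _ / (D / _).
rewrite !ler_norml => /andP[? ?] /andP[? ?]; apply/andP; split; lra.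
Qed.

(** The optimum is at least the modularity of the planted partition, whose defect
    is zero. *)
Lemma defect_lt (A : {ffun 'I_k -> {set V}}) delta : kpartition A ->
  max_modularity R E - delta < modularity R E (parts A) ->
  (a - b) * defect (profile A)
    < delta * (D * k%:R ^+ 2) + 24 * k%:R ^+ 4 * eta.
Proof.
move=> kA hA.
have P0 i : P i != set0 by rewrite -card_gt0 (block_gt0 k_gt0 bP kV).
have hP := modularity_parts_le R kP E P0.
have := modularity_close kA; have := modularity_close kP.
rewrite /limit_modularity defect_planted.
have C0 : 0 < D * k%:R ^+ 2 by rewrite mulr_gt0 // exprn_gt0.
set d := defect _; rewrite !ler_norml => /andP[h1 _] /andP[_ h2].
have h : (a - b) / (D * k%:R ^+ 2) * d < delta + 24 * k%:R ^+ 2 * eta / D.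
  move: h1 h2 hA hP; rewrite !mulrBr; set c := (a - b) / _.
  have -> : 24 * k%:R ^+ 2 * eta / D = 2 * (12 * k%:R ^+ 2 * eta / D) by ring.
  set K := 12 * _ * _ / _; lra.
rewrite -(ltr_pM2r C0) in h.
have e1 : (a - b) / (D * k%:R ^+ 2) * d * (D * k%:R ^+ 2) = (a - b) * d.
  by field; rewrite !gt_eqF.
have e2 : (delta + 24 * k%:R ^+ 2 * eta / D) * (D * k%:R ^+ 2)
    = delta * (D * k%:R ^+ 2) + 24 * k%:R ^+ 4 * eta.
  by field; rewrite gt_eqF.
by rewrite e1 e2 in h.
Qed.

End Stability.

Section Distance.
Variables (R : realType) (V : finType) (k : nat) (P : {ffun 'I_k -> {set V}}).
Hypotheses (k_ge2 : (2 <= k)%N) (kP : kpartition P) (bP : balanced P).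
Hypothesis kV : (k <= #|V|)%N.
Let k_gt0 : (0 < k)%N := ltnW k_ge2.
Local Notation N := (#|V|%:R : R).

Lemma kdist_le_misplaced (A : {ffun 'I_k -> {set V}}) (s : 'S_k) : kpartition A ->
  kdist R A P <= (k%:R^-1 + N^-1) * misplaced (profile R P A) s.
Proof.
move=> kA; have N0 : 0 < N by rewrite ltr0n (leq_trans k_gt0).
apply: (@le_trans _ _ (1 - (\sum_i #|A (s i) :&: P i|)%N%:R / N)).
  rewrite /kdist lerD2l lerN2 ler_pM2r ?invr_gt0 // ler_nat.
  exact: (@leq_bigmax _ (fun s : 'S_k => (\sum_i #|A (s i) :&: P i|)%N) s).
have oneE : 1 = (\sum_i #|P i|)%N%:R / N.
  have := sum_card_blocks kP [set: V]; under eq_bigr do rewrite setTI.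
  by move=> ->; rewrite cardsT divff // gt_eqF.
rewrite [X in X - _]oneE !natr_sum -mulrBl -sumrB mulr_suml /misplaced mulr_sumr.
apply: ler_sum => j _.
have p0 : 0 < #|P j|%:R :> R by rewrite ltr0n (block_gt0 k_gt0 bP kV).
have -> : (#|P j|%:R - #|A (s j) :&: P j|%:R) / N
    = #|P j|%:R / N * (1 - profile R P A (s j) j) :> R.
  by rewrite /profile /fraction; field; rewrite !gt_eqF.
apply: ler_wpM2r.
  rewrite subr_ge0; apply: stochastic_le1.
  exact: profile_stochastic.
have := block_size R k_gt0 bP kV j; rewrite ler_norml => /andP[_]; lra.
Qed.

Lemma kdist_le_defect (A : {ffun 'I_k -> {set V}}) : kpartition A ->
  defect (profile R P A) < 2 ->
  kdist R A P <= defect (profile R P A) / (2 * k%:R * (k%:R - 1)) + N^-1.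
Proof.
move=> kA d2; have SX := profile_stochastic R k_ge2 bP kV kA.
have [s us] := exists_misplaced_le_defect k_ge2 SX d2.
apply: le_trans (kdist_le_misplaced s kA) _.
have k2 : 2 <= k%:R :> R by rewrite (ler_nat _ 2).
have N0 : 0 <= N^-1 by rewrite invr_ge0.
have u0 := misplaced_ge0 s SX.
move: us d2 u0; set u := misplaced _ _; set d := defect _ => us d2 u0.
have u1 : u <= 1 by nra.
rewrite mulrDl; apply: lerD; last by rewrite ler_piMr.
have k1 : 0 < k%:R * (k%:R - 1) :> R by rewrite mulr_gt0 //; lra.
rewrite ler_pdivlMr; last by rewrite -mulrA mulr_gt0.
have -> : k%:R^-1 * u * (2 * k%:R * (k%:R - 1)) = 2 * (k%:R - 1) * u.
  by field; rewrite gt_eqF //; lra.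
by [].
Qed.
End Distance.

(** * Choice of the constants *)

(** Union bound over 2^n sets with deviation (eta / 2) omega n.  Since lam is at
    most eta / (4 a), the quadratic term of the exponent is at most half of the
    linear one, so the left-hand side is at most 2 z^n with
    z = 2 exp (- omega lam eta / 4), and a constant lower bound on omega makes z
    as small as desired. *)
Lemma deviation_bound_small (R : realType) (a eta eps : R) :
  0 < a -> 0 < eta -> 0 < eps ->
  exists2 c : R, 0 < c & exists2 lam : R, 0 <= lam <= 1 / 2 &
  forall (omega : R) (n : nat), (0 < n)%N -> c < omega ->
  2 ^+ n * (2 * expR (lam ^+ 2 * (omega * a / n%:R * n%:R ^+ 2)
                      - lam * (eta / 2 * (omega * n%:R)))) <= eps.
Proof.
move=> a0 eta0 eps0.
pose lam := Num.min (1 / 2) (eta / (4 * a)).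
have lam0 : 0 < lam by rewrite lt_min !divr_gt0 // mulr_gt0.
have lam2 : lam <= 1 / 2 by rewrite ge_min lexx.
have lama : lam * a <= eta / 4.
  rewrite -ler_pdivlMr // (_ : eta / 4 / a = eta / (4 * a)) ?ge_min ?lexx ?orbT //.
  by field; rewrite gt_eqF.
pose L := lam * (eta / 4); have L0 : 0 < L by rewrite mulr_gt0 // divr_gt0.
exists ((1 + 4 / eps) / L); first by rewrite divr_gt0 // addr_gt0 // divr_gt0.
exists lam; first by rewrite (ltW lam0).
move=> omega n n0; rewrite ltr_pdivrMr // => oL.
have e4 : 0 < 4 / eps by rewrite divr_gt0.
have o0 : 0 < omega by rewrite -(pmulr_lgt0 _ L0); lra.
have nR : 0 < n%:R :> R by rewrite ltr0n.
pose z := 2 * expR (- (omega * L)).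
have z0 : 0 <= z by rewrite mulr_ge0 // expR_ge0.
have zle : z <= 2 / (1 + omega * L).
  rewrite /z expRN ler_pM2l // lef_pV2 ?posrE ?expR_gt0 //; first exact: expR_ge1Dx.
  by rewrite addr_gt0 // mulr_gt0.
have oL0 : 0 < 1 + omega * L by rewrite addr_gt0 // mulr_gt0.
have z1 : z <= 1.
  apply: le_trans zle _; rewrite ler_pdivrMr // mul1r; lra.
have z2 : z <= eps / 2.
  apply: le_trans zle _; rewrite ler_pdivrMr //.
  have two : 2 = eps / 2 * (4 / eps) by field; rewrite gt_eqF.
  by rewrite [leLHS]two ler_pM2l ?divr_gt0 //; lra.
apply: (@le_trans _ _ (2 * z ^+ n)).
  rewrite /z exprMn mulrCA -expRM_natr ler_pM2l // ler_pM2l ?exprn_gt0 // ler_expR.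
  have -> : lam ^+ 2 * (omega * a / n%:R * n%:R ^+ 2)
       - lam * (eta / 2 * (omega * n%:R))
     = (lam * (lam * a) - lam * (eta / 2)) * (omega * n%:R).
    by field; rewrite gt_eqF.
  have -> : - (omega * L) * n%:R = - L * (omega * n%:R) by ring.
  rewrite ler_pM2r ?mulr_gt0 // /L.
  have : lam * (lam * a) <= lam * (eta / 4) by rewrite ler_pM2l.
  lra.
have zn : z ^+ n <= z by rewrite -[leRHS]expr1 ler_wiXn2l.
lra.
Qed.

Section Constants.
Variables (R : realType) (a b : R) (k : nat).
Hypotheses (b_gt0 : 0 < b) (b_lt_a : b < a) (k_ge2 : (2 <= k)%N).
Local Notation D := (a + (k%:R - 1) * b).

(** For delta <= 0 the linear bound is not positive, and any number in the
    allowed interval will do. *)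
Definition max_distance (delta : R) : R :=
  if 0 < delta then delta * (k%:R * D) / (2 * (k%:R - 1) * (a - b))
  else 1 / (2 * (k%:R * (k%:R - 1))).

Let k2 : 2 <= k%:R :> R. Proof. by rewrite (ler_nat _ 2). Qed.
Let k1 : 0 < k%:R - 1 :> R. Proof. by rewrite subr_gt0 ltr1n. Qed.
Let k0 : 0 < k%:R :> R. Proof. by rewrite ltr0n ltnW. Qed.
Let D0 : 0 < D.
Proof. by apply: addr_gt0; [exact: lt_trans b_lt_a|rewrite mulr_gt0]. Qed.
Let ab0 : 0 < a - b. Proof. by rewrite subr_gt0. Qed.

Lemma max_distance_bounds delta : delta < (a - b) / D * (2 / k%:R ^+ 2) ->
  0 < max_distance delta < 1 / (k%:R * (k%:R - 1)).
Proof.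
move=> hd; rewrite /max_distance; have [d0|d0] := ltP 0 delta; last first.
  rewrite !div1r invr_gt0 ltf_pV2 ?posrE ?mulr_gt0 //=.
  by rewrite ltr_pMl ?mulr_gt0 // ltr1n.
rewrite divr_gt0 ?mulr_gt0 //= ltr_pdivrMr ?mulr_gt0 //.
have -> : 1 / (k%:R * (k%:R - 1)) * (2 * (k%:R - 1) * (a - b))
    = (a - b) / D * (2 / k%:R ^+ 2) * (k%:R * D).
  by field; rewrite !gt_eqF.
by rewrite ltr_pM2r // mulr_gt0.
Qed.

Lemma max_distance_ge delta :
  delta * (k%:R * D) / (2 * (k%:R - 1) * (a - b)) <= max_distance delta.
Proof.
rewrite /max_distance; have [d0|d0] := ltP 0 delta => //.
apply: (@le_trans _ _ 0).
  rewrite pmulr_lle0 ?invr_gt0 ?mulr_gt0 // pmulr_lle0 ?mulr_gt0 //.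
by rewrite divr_ge0 // ltW // !mulr_gt0.
Qed.

(** The error allowed in the edge densities.  The three terms ensure that the
    graph has edges, that the defect stays below 2, and that the resulting error
    in the distance is at most eps / 2. *)
Definition tolerance (eps delta : R) : R :=
  Num.min (D / (4 * k%:R))
    (Num.min ((2 * (a - b) - delta * (D * k%:R ^+ 2)) / (24 * k%:R ^+ 4))
             (eps * ((a - b) * (k%:R - 1)) / (24 * k%:R ^+ 3))).

Lemma tolerance_gt0 eps delta : 0 < eps ->
  delta < (a - b) / D * (2 / k%:R ^+ 2) -> 0 < tolerance eps delta.
Proof.
move=> e0 hd; rewrite !lt_min !divr_gt0 ?mulr_gt0 ?exprn_gt0 //= subr_gt0.
rewrite -ltr_pdivlMr ?mulr_gt0 ?exprn_gt0 //.
have -> : 2 * (a - b) / (D * k%:R ^+ 2) = (a - b) / D * (2 / k%:R ^+ 2).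
  by field; rewrite !gt_eqF.
by [].
Qed.

Lemma near_optimal_close (V : finType) (P A : {ffun 'I_k -> {set V}})
    (omega eps delta : R) (E : {set {set V}}) :
  kpartition P -> balanced P -> (k <= #|V|)%N -> 0 < omega -> E \subset vpairs V ->
  0 < eps -> delta < (a - b) / D * (2 / k%:R ^+ 2) ->
  #|V|%:R^-1 <= eps / 2 ->
  (forall S, `|(edges_in E S)%:R / (omega * #|V|%:R) - edge_density P a b S|
     <= tolerance eps delta) ->
  kpartition A ->
  max_modularity R E - delta < modularity R E (parts A) ->
  kdist R A P < max_distance delta + eps.
Proof.
move=> kP bP kV o0 EV e0 hd hN hE kA hA.
set eta := tolerance eps delta in hE.
have eta0 : 0 < eta by apply: tolerance_gt0.
have eta1 : eta < D / (2 * k%:R).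
  apply: (@le_lt_trans _ _ (D / (4 * k%:R))).
    by rewrite /eta /tolerance ge_min lexx.
  by rewrite ltr_pM2l // ltf_pV2 ?posrE ?mulr_gt0 // ltr_pM2r // ltr_nat.
have eta2 : 24 * k%:R ^+ 4 * eta <= 2 * (a - b) - delta * (D * k%:R ^+ 2).
  rewrite mulrC -ler_pdivlMr ?mulr_gt0 ?exprn_gt0 //.
  by rewrite /eta /tolerance !ge_min lexx !orbT.
have eta3 : 24 * k%:R ^+ 3 * eta <= eps * ((a - b) * (k%:R - 1)).
  rewrite mulrC -ler_pdivlMr ?mulr_gt0 ?exprn_gt0 //.
  by rewrite /eta /tolerance !ge_min lexx !orbT.
have hdef := defect_lt k_ge2 kP bP kV b_gt0 b_lt_a o0 EV eta1 hE kA hA.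
have def2 : defect (profile R P A) < 2 by rewrite -(ltr_pM2l ab0); lra.
apply: le_lt_trans (kdist_le_defect k_ge2 kP bP kV kA def2) _.
have := max_distance_ge delta; move: hdef hN.
set d := defect _; set m := max_distance _; set Ni := _^-1 => hdef hN hm.
have K0 : 0 < 2 * k%:R * (k%:R - 1) :> R by rewrite !mulr_gt0.
suff : d / (2 * k%:R * (k%:R - 1))
    < delta * (k%:R * D) / (2 * (k%:R - 1) * (a - b)) + eps / 2.
  lra.
rewrite ltr_pdivrMr // -(ltr_pM2l ab0); apply: lt_le_trans hdef _.
have -> : (a - b) * ((delta * (k%:R * D) / (2 * (k%:R - 1) * (a - b)) + eps / 2)
     * (2 * k%:R * (k%:R - 1)))
   = delta * (D * k%:R ^+ 2) + k%:R * (eps * ((a - b) * (k%:R - 1))).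
  by field; rewrite !gt_eqF.
rewrite lerD2l (_ : 24 * k%:R ^+ 4 * eta = k%:R * (24 * k%:R ^+ 3 * eta)).
  by rewrite ler_pM2l.
by ring.
Qed.
End Constants.

(** * The theorem *)

Local Open Scope classical_set_scope.

Theorem theorem2p5 (R : realType) (a b : R) (k : nat)
    (b_gt0 : 0 < b) (b_lt_a : b < a) (k_ge2 : (2 <= k)%N) :
  exists delta' : R -> R,
  forall eps delta : R, 0 < eps ->
    delta < (a - b) / (a + (k%:R - 1) * b) * (2 / k%:R ^+ 2) ->
  0 < delta' delta < 1 / (k%:R * (k%:R - 1)) /\
  exists c : R, forall omega : nat -> R,
    (\forall n \near \oo, omega n * a / n%:R <= 1) ->
    (\forall n \near \oo, c < omega n) ->
  \forall n \near \oo,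
    forall P : {ffun 'I_k -> {set 'I_n}}, kpartition P -> balanced P ->
    1 - eps <=
      sbm_prob P (omega n * a / n%:R) (omega n * b / n%:R)
        (fun E : {set {set 'I_n}} =>
          [forall A : {ffun 'I_k -> {set 'I_n}},
            (kpartition A
             && (max_modularity R E - delta < modularity R E (parts A)))
            ==> (kdist R A P < delta' delta + eps)]).
Proof.
have a_gt0 : 0 < a := lt_trans b_gt0 b_lt_a.
exists (max_distance a b k) => eps delta eps0 hdelta.
split; first exact: max_distance_bounds.
set eta := tolerance a b k eps delta.
have eta0 : 0 < eta by apply: tolerance_gt0.
have [c c0 [lam lam01 small]] := deviation_bound_small a_gt0 eta0 eps0.
exists c => omega hp homega; near=> n.
move=> P kP bP.
have kn : (k <= n)%N.
  by rewrite -(ler_nat R); near: n; exact: nbhs_infty_ger.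
have n0 : (0 < n)%N by apply: leq_trans kn; apply: ltnW.
have nR : 0 < n%:R :> R by rewrite ltr0n.
have o1 : c < omega n by near: n.
have p1 : omega n * a / n%:R <= 1 by near: n.
have o0 : 0 < omega n by apply: lt_trans o1.
have qp : 0 <= omega n * b / n%:R <= omega n * a / n%:R.
  apply/andP; split; first by rewrite divr_ge0 // mulr_ge0 // ltW.
  by rewrite ler_pM2r ?invr_gt0 // ler_pM2l // ltW.
have n1 : (k%:R + 1) * a / n%:R <= eta / 2.
  rewrite ler_pdivrMr // -ler_pdivrMl ?divr_gt0 //.
  by near: n; exact: nbhs_infty_ger.
have n2 : n%:R^-1 <= eps / 2.
  rewrite -[leRHS]invrK lef_pV2 ?posrE ?invr_gt0 ?divr_gt0 //.
  by near: n; exact: nbhs_infty_ger.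
have conc := sbm_edges_concentrate P (eta / 2 * (omega n * n%:R)) qp p1 lam01.
have small_n := small _ _ n0 o1.
rewrite card_ord in conc.
apply: le_trans (_ : _ <= 1 - _) _; last apply: le_trans conc _.
  by rewrite lerD2l lerN2; exact: small_n.
apply: sbm_prob_mono qp p1 _ => E EV /forallP hE.
apply/forallP => A; apply/implyP => /andP[kA hA].
apply: (near_optimal_close b_gt0 b_lt_a k_ge2 kP bP _ o0 EV eps0 hdelta) => //.
- by rewrite card_ord.
- by rewrite card_ord.
move=> S; rewrite -/eta.
have kV : (k <= #|'I_n|)%N by rewrite card_ord.
have := mean_edges_close (ltnW k_ge2) kP bP kV S b_gt0 b_lt_a o0.
rewrite card_ord => mc; have oN : 0 < omega n * n%:R by rewrite mulr_gt0.
(* Half of eta is for the random fluctuation of the edge count, the other half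
   for the error terms in its mean. *)
rewrite -(subrKA (mean_edges P (omega n * a / n%:R) (omega n * b / n%:R) S
                  / (omega n * n%:R))).
apply: le_trans (ler_normD _ _) _.
have -> : eta = eta / 2 + eta / 2 by field.
apply: lerD; last exact: le_trans mc n1.
rewrite -mulrBl normrM [`|_^-1|]gtr0_norm ?invr_gt0 // ler_pdivrMr //.
Unshelve. all: by end_near.
Qed.
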